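(* Let $n \geq 1$, let $u_n := 3\cdot 2^{n-2}-1$, let $\mathsf{C}_n$ be the tropical central path of the family of linear programs $(\mathrm{CEX}_n(t))_{t>1}$, and for an interval $I$ let $\gamma(I)$ be the minimal number of tropical segments needed to describe $\mathsf{C}_n(I)$. Then $$\gamma([0,u_n-1]) = 2^{n-1}-1, \qquad \gamma([0,2u_n-1]) = 2^n-2, \qquad \gamma([0,2u_n]) = \gamma([0,+\infty[) = 2^n-1 .$$
   Context: Set $u_k := 3\cdot 2^{k-2} - 1$ for $k\geq 1$, $\mathbb{T} := \mathbb{R}\cup\{-\infty\}$, and write $a\vee b := \max(a,b)$ (entrywise for vectors); $e$ is the all-ones vector. The tropical central path $\mathsf{C}_n$ is the map sending $\lambda\in\mathbb{R}$ to the entrywise supremum (the ''tropical barycenter'') of the set of points $x \in \mathbb{T}^n$ satisfying $x_n \leq -\lambda$ and $$\bigvee_{j = 1}^{i-1} (-u_i + x_j) \vee (-u_{i+1} + 1 + x_i) \leq \bigvee_{j = i+1}^{n-1} (-u_j + x_j) \vee x_n \vee (-u_n) \quad (i = 1, \dots, n-1),$$ $$\bigvee_{j = 1}^n x_j \leq 0, \qquad -\infty \leq x_1 \leq x_2 \leq \dots \leq x_{n-1} \leq u_n + x_n .$$ (These tropical inequalities define the limit, as $t\to\infty$, of the image under the entrywise map $\log_t$ of the feasible set of the linear program $\mathrm{CEX}_n(t)$: minimize $x_n$ subject to $t^{-u_i} (\sum_{j < i} x_j) + t^{-u_{i+1} + 1} x_i \leq \sum_{j = i+1}^{n-1} t^{-u_j}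 x_j + x_n + t^{-u_n}$ for $1\leq i\leq n-1$, $\sum_{j = 1}^n x_j \leq 1$, $0 \leq x_1 \leq \dots \leq x_{n-1} \leq t^{u_n} x_n$.) Tropical segments: for $u,v\in\mathbb{T}^n$, $\operatorname{tsegm}(u,v) := \{(u+\lambda e)\vee(v+\mu e) : \lambda,\mu\in\mathbb{T},\ \lambda\vee\mu = 0\}$. For an interval $[a,b]$ with $a\le b\leq+\infty$ (for $b=+\infty$ the interval is $[a,+\infty[$), $\gamma([a,b])$ is the smallest integer $p\geq 0$ such that there exist $a=\lambda_0\leq\lambda_1\leq\dots\leq\lambda_p=b$ with $\mathsf{C}_n([\lambda_{i-1},\lambda_i]) = \operatorname{tsegm}(\mathsf{C}_n(\lambda_{i-1}),\mathsf{C}_n(\lambda_i))$ for all $i=1,\dots,p$, where $\mathsf{C}_n(+\infty)$ denotes the limit of $\mathsf{C}_n(\lambda)$ in $\mathbb{T}^n$ as $\lambda\to+\infty$. If the interval is empty or reduced to a point, $\gamma$ is $0$. *)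

(* Defs.v *)
From HB Require Import structures.
From mathcomp Require Import all_boot all_order all_algebra.
From mathcomp Require Import all_classical all_reals all_analysis.

Set Implicit Arguments.
Unset Strict Implicit.
Unset Printing Implicit Defensive.

Import Order.TTheory GRing.Theory Num.Theory.
Import numFieldNormedType.Exports.

Local Open Scope classical_set_scope.
Local Open Scope ring_scope.

(* The exponent is an integer: u_1 = 1/2. *)
Definition useq (R : realType) (k : nat) : R := 3 * 2 ^ (k%:Z - 2) - 1.

Local Open Scope ereal_scope.

(* T = R U {-oo} is rendered inside \bar R, so that tropical sum is [maxe] and
   tropical product is [+%E]; points of T^n are the vectors without +oo. *)
Definition tropical_vectors (R : realType) (n : nat) : set ('I_n -> \bar R) :=
  [set x | forall i, x i < +oo].

(* 1-based coordinate x_k; -oo when k = 0 or k > n. *)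
Definition coord (R : realType) (n : nat) (x : 'I_n -> \bar R) (k : nat) :
    \bar R :=
  if k is j.+1 then oapp x -oo (insub j) else -oo.

Definition cex_tropical_points (R : realType) (n : nat) (lambda : R) :
    set ('I_n -> \bar R) :=
  [set x | let u := useq R in let x_ := coord x in
    [/\ tropical_vectors x,
        x_ n <= (- lambda)%:E,
        (forall i : nat, (1 <= i < n)%N ->
           maxe (\big[maxe/-oo]_(1 <= j < i) ((- u i)%:E + x_ j))
                ((- u i.+1 + 1)%:E + x_ i)
           <= maxe (maxe (\big[maxe/-oo]_(i.+1 <= j < n) ((- u j)%:E + x_ j))
                         (x_ n))
                   (- u n)%:E),
        \big[maxe/-oo]_(1 <= j < n.+1) x_ j <= 0
      & (forall i : nat, (1 <= i)%N -> (i.+1 < n)%N -> x_ i <= x_ i.+1) /\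
        ((1 < n)%N -> x_ n.-1 <= (u n)%:E + x_ n)]].

Arguments cex_tropical_points {R} n lambda _.

(* The suprema are never +oo, as all coordinates of the points are <= 0. *)
Definition tropical_central_path (R : realType) (n : nat) (lambda : R) :
    'I_n -> \bar R :=
  fun k => ereal_sup [set x k | x in cex_tropical_points n lambda].

Arguments tropical_central_path {R} n lambda _.

(* The value at -oo is irrelevant: parameters below never go under a real. *)
Definition extended_central_path (R : realType) (n : nat) (lambda : \bar R) :
    'I_n -> \bar R :=
  match lambda with
  | r%:E => tropical_central_path n r
  | +oo => fun k => lim (tropical_central_path n r k @[r --> +oo%R])
  | -oo => fun k => lim (tropical_central_path n r k @[r --> -oo%R])
  end.

Arguments extended_central_path {R} n lambda _.

(* [maxe l m = 0] forces l and m to be different from +oo. *)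
Definition tsegm (R : realType) (n : nat) (x y : 'I_n -> \bar R) :
    set ('I_n -> \bar R) :=
  [set z | exists l m : \bar R,
     maxe l m = 0 /\ z = (fun k => maxe (x k + l) (y k + m))].

Definition central_path_pieces (R : realType) (n : nat) (a b : \bar R)
    (p : nat) : Prop :=
  exists lambda : nat -> \bar R,
    [/\ lambda 0%N = a, lambda p = b,
        (forall i : nat, (i < p)%N -> lambda i <= lambda i.+1)
      & (forall i : nat, (i < p)%N ->
           extended_central_path n @`
             [set t | lambda i <= t <= lambda i.+1] =
           tsegm (extended_central_path n (lambda i))
                 (extended_central_path n (lambda i.+1)))].

(* [is_gamma n a b p] reads "gamma([a, b]) is defined and equal to p"; the
   interval [a, +oo[ is encoded by b = +oo. *)
Definition is_gamma (R : realType) (n : nat) (a : R) (b : \bar R) (p : nat) :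
    Prop :=
  if a%:E <= b then
    central_path_pieces n a%:E b p /\
    (forall q : nat, central_path_pieces n a%:E b q -> (p <= q)%N)
  else p = 0%N.

(* Main.v *)
(* For lambda >= 0 the barycenter is computed from the last coordinate down:
   x_n = -lambda, and each x_i is the greatest value allowed by the coordinates
   above it. If R_i denotes the right-hand side of the i-th inequality, the gap
   x_i - R_i is the image of the gap x_(i+1) - R_(i+1) by the tent map
   d |-> min(d, u - 1, 2u - d) with u = u_(i+1), which folds [0, 2 u_(i+1)] onto
   [0, 2 u_i] twice because u_(i+1) - 1 = 2 u_i. Hence every x_i moves with slope
   0 or -1, and the symmetry d |-> 2u - d exchanges the moments at which x_i
   moves with those at which it rests. Since x_n always moves, a tropical segment
   is a stretch of the path along which no resting coordinate starts to move. By
   induction with the symmetry, such starts occur exactly at the integers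
   1, 3, 4, 6, 7, ... below 2 u_n that are congruent to 0 or 1 modulo 3. *)
Require Import Defs.
From mathcomp Require Import all_boot all_order all_algebra.
From mathcomp Require Import all_classical all_reals all_analysis.
From mathcomp Require Import zify ring lra.

Import Order.TTheory GRing.Theory Num.Theory.
Import numFieldNormedType.Exports.

Local Open Scope classical_set_scope.
Local Open Scope ring_scope.

Ltac min_max_free e :=
  lazymatch e with
  | context [Num.min _ _] => fail
  | context [Num.max _ _] => fail
  | _ => idtac
  end.

(* Innermost first, so that the hypotheses handed to [lra] are linear. *)
Ltac min_max_lra :=
  repeat match goal with
  | |- context [Num.min ?x ?y] =>
      min_max_free x; min_max_free y; case: (leP x y) => ?
  | |- context [Num.max ?x ?y] =>
      min_max_free x; min_max_free y; case: (leP x y) => ?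
  end; lra.

(** * Scalar model: gaps, coordinate differences, breakpoints *)

Definition tent {R : realType} (u d : R) : R :=
  Num.min d (Num.min (u - 1) (2 * u - d)).

(** With u = u_(i+1) and d the gap at i + 1, the three terms are the upper bounds on x_i - x_(i+1)
    given by monotonicity, by the term x_i in the inequality of index i + 1, and by the inequality
    of index i. *)
Definition drop {R : realType} (u d : R) : R :=
  Num.min 0 (Num.min (u - d) (Num.max (u - 1 - d) (- 1))).

(* Gap x_i - R_i when the gap at index k is d. *)
Fixpoint level {R : realType} (k i : nat) (d : R) : R :=
  if k is k'.+1 then
    if (i < k)%N then level k' i (tent (useq R k) d) else d
  else d.

(* Difference x_i - x_k when the gap at index k is d, with x_n read as 0. *)
Fixpoint profile {R : realType} (k i : nat) (d : R) : R :=
  if k is k'.+1 then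
    if (i < k)%N then drop (useq R k) d + profile k' i (tent (useq R k) d)
    else 0
  else 0.

(** The values 0, 1, 3, 4, 6, 7, ... enumerate the naturals congruent to 0 or 1 modulo 3. *)
Definition breakpoint (j : nat) : nat := (j + j %/ 2)%N.

(** One coordinate of a tropical segment: the left end is lowered by t - a and the right end is kept
    fixed. *)
Definition falls_then_rests {R : realType} (f : R -> R) (a b : R) : Prop :=
  forall t, a <= t <= b -> f t = Num.max (f a - (t - a)) (f b).

Definition starts_falling {R : realType} (f : R -> R) (s : R) : Prop :=
  forall t, 0 <= t <= 1 -> f (s - t) = f s /\ f (s + t) = f s - t.

(** * Arithmetic of u_k and of the breakpoints *)

Lemma useqS (R : realType) (k : nat) : useq R k.+1 = 2 * useq R k + 1.
Proof.
rewrite /useq.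
have -> : k.+1%:Z - 2 = (k%:Z - 2) + 1 by lia.
by rewrite expfzDr // expr1z; ring.
Qed.

Lemma useq1 (R : realType) : 2 * useq R 1 = 1.
Proof. by rewrite /useq /= -[1%:Z - 2]/(- 1%:Z) exprN1; field. Qed.

Lemma useq_breakpoint (R : realType) (k : nat) :
  (0 < k)%N -> 2 * useq R k = (breakpoint (2 ^ k - 1))%:R.
Proof.
case: k => // k _; elim: k => [|k IHk]; first by rewrite useq1.
rewrite useqS mulrDr IHk /breakpoint !expnS.
have : (0 < 2 ^ k)%N by rewrite expn_gt0.
move: (2 ^ k)%N => m m_gt0.
rewrite mulr1 -!natrM -natrD; congr _%:R; lia.
Qed.

(** Since 2 u_k is congruent to 1 modulo 3, the reflection d |-> 2 u_k - d swaps the residues 0 and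
    1, so it reverses the list of breakpoints. *)
Lemma breakpointB (R : realType) (k j : nat) : (0 < k)%N -> (j < 2 ^ k)%N ->
  (breakpoint (2 ^ k - 1 - j))%:R = 2 * useq R k - (breakpoint j)%:R.
Proof.
move=> k_gt0 jk; rewrite useq_breakpoint //.
case: k k_gt0 jk => // k _; rewrite /breakpoint expnS.
move: (2 ^ k)%N => m jm; rewrite -natrB; last by lia.
congr _%:R; lia.
Qed.

Lemma breakpointS (R : realType) (k : nat) : (0 < k)%N ->
  useq R k.+1 - 1 = (breakpoint (2 ^ k - 1))%:R.
Proof. by move=> k_gt0; rewrite -useq_breakpoint // useqS; ring. Qed.

Lemma leq_breakpoint (i j : nat) : (i <= j)%N -> (breakpoint i <= breakpoint j)%N.
Proof. rewrite /breakpoint; lia. Qed.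

Lemma ltn_breakpoint (i j : nat) : (i < j)%N -> (breakpoint i < breakpoint j)%N.
Proof. rewrite /breakpoint; lia. Qed.

(** * Unfolding the recursion at either end *)

Lemma profile_step (R : realType) (k i : nat) (d : R) : (i <= k)%N ->
  profile k.+1 i d = drop (useq R k.+1) d + profile k i (tent (useq R k.+1) d).
Proof. by move=> ik /=; rewrite ltnS ik. Qed.

Lemma level_step (R : realType) (k i : nat) (d : R) : (i <= k)%N ->
  level k.+1 i d = level k i (tent (useq R k.+1) d).
Proof. by move=> ik /=; rewrite ltnS ik. Qed.

Lemma profile_out (R : realType) (k i : nat) (d : R) :
  (k <= i)%N -> profile k i d = 0.
Proof. by case: k => //= k ki; rewrite ltnNge ki. Qed.

Lemma level_out (R : realType) (k i : nat) (d : R) :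
  (k <= i)%N -> level k i d = d.
Proof. by case: k => //= k ki; rewrite ltnNge ki. Qed.

(** The definitions unfold at the top index k, whereas the constraints link i to i + 1; this lemma
    and [profile_pred] unfold at the bottom index. *)
Lemma level_pred (R : realType) (k i : nat) (d : R) : (i < k)%N ->
  level k i d = tent (useq R i.+1) (level k i.+1 d).
Proof.
elim: k d => // k IHk d; rewrite ltnS leq_eqVlt => /orP[/eqP <-|ik].
  by rewrite level_step // !level_out.
by rewrite !level_step ?(ltnW ik) // IHk.
Qed.

Lemma profile_pred (R : realType) (k i : nat) (d : R) : (i < k)%N ->
  profile k i d = profile k i.+1 d + drop (useq R i.+1) (level k i.+1 d).
Proof.
elim: k d => // k IHk d; rewrite ltnS leq_eqVlt => /orP[/eqP <-|ik].
  by rewrite profile_step // !profile_out // level_out // addr0 add0r.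
by rewrite !profile_step ?level_step ?(ltnW ik) // IHk // addrA.
Qed.

(** This is R_i - x_(i+1), as R_i is the larger of x_(i+1) - u and R_(i+1) = x_(i+1) - d. *)
Lemma dropB_tent (R : realType) (u d : R) :
  drop u d - tent u d = Num.max (- d) (- u).
Proof. rewrite /drop /tent; min_max_lra. Qed.

Lemma tent_id (R : realType) (u d : R) : d <= u - 1 -> tent u d = d.
Proof. rewrite /tent; min_max_lra. Qed.

Lemma drop0 (R : realType) (u d : R) : d <= u - 1 -> drop u d = 0.
Proof. rewrite /drop; min_max_lra. Qed.

Lemma tent_sym (R : realType) (u d : R) : tent u (2 * u - d) = tent u d.
Proof. rewrite /tent; min_max_lra. Qed.

Lemma drop_sym (R : realType) (u d : R) :
  drop u (2 * u - d) = drop u d + (d - u).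
Proof. rewrite /drop; min_max_lra. Qed.

Lemma tent_mid (R : realType) (u d : R) :
  u - 1 <= d <= u + 1 -> tent u d = u - 1.
Proof. rewrite /tent; min_max_lra. Qed.

Lemma drop_mid (R : realType) (u d : R) :
  u - 1 <= d <= u + 1 -> drop u d = Num.max (u - 1 - d) (- 1).
Proof. rewrite /drop; min_max_lra. Qed.

(** * Shape of the profile: symmetry, slopes, starts and pieces *)

Lemma profile_id (R : realType) (k i : nat) (d : R) : (i <= k)%N ->
  d <= useq R k.+1 - 1 -> profile k.+1 i d = profile k i d.
Proof. by move=> ik dk; rewrite profile_step // tent_id // drop0 // add0r. Qed.

(** Only the top step sees the reflection: [tent] is invariant, so all lower levels agree, and
    [drop] contributes the shift. *)
Lemma profile_sym (R : realType) (k i : nat) (d : R) : (i < k)%N ->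
  profile k i (2 * useq R k - d) = profile k i d + (d - useq R k).
Proof.
case: k => // k ik.
by rewrite !profile_step // tent_sym drop_sym addrAC.
Qed.

(** Both [drop] and [drop - tent] are nonincreasing and 1-Lipschitz; which of them gives which bound
    depends on whether the tent map rises or falls from d to d'. *)
Lemma profile_lipschitz (R : realType) (k i : nat) (d d' : R) : d <= d' ->
  profile k i d' <= profile k i d <= profile k i d' + (d' - d).
Proof.
elim: k d d' => [|k IHk] d d' dd' /=; first by lra.
case: ifP => _; last by lra.
move: (useq R k.+1) => u.
have : drop u d' <= drop u d <= drop u d' + (d' - d).
  by rewrite /drop; min_max_lra.
have : 0 <= (drop u d - tent u d) - (drop u d' - tent u d') <= d' - d.
  by rewrite !dropB_tent; min_max_lra.
have [tt'|/ltW tt'] := leP (tent u d) (tent u d'); have := IHk _ _ tt'; lra.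
Qed.

(** For k >= 1, u_(k+1) - 1 = 2 u_k >= 1, so every tent map involved fixes d. *)
Lemma profile_le1 (R : realType) (k i : nat) (d : R) : (0 < i)%N ->
  d <= 1 -> profile k i d = 0.
Proof.
move=> i_gt0 d1; elim: k => // k IHk.
have [ik|ki] := leqP i k; last by rewrite profile_out.
rewrite profile_id // breakpointS; last by lia.
have k_gt0 : (0 < k)%N by lia.
apply: le_trans d1 _; rewrite (ler_nat _ 1) (@leq_breakpoint 1) //.
by rewrite -subn_gt0 -subnDA subn_gt0 -{1}[2%N]expn1 leq_pexp2l.
Qed.

(** Mirror image of the rest on d <= 1: near the end of the range every coordinate falls with slope
    -1, and does so for ever. *)
Lemma profile_tail (R : realType) (k i : nat) (d : R) : (0 < i < k)%N ->
  2 * useq R k - 1 <= d -> profile k i d = useq R k - d.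
Proof.
move=> /andP[i_gt0 ik] kd.
rewrite -[d in LHS](subKr (2 * useq R k)) profile_sym // profile_le1 //; lra.
Qed.

(* The half [u_k + 1, 2 u_k] is the mirror image of [0, u_k - 1], where the
   profile is that of level k - 1; x_(k-1) itself starts at u_k - 1 and at
   u_k + 1. *)
Lemma starts_falling_profile (R : realType) (k j : nat) :
  (0 < j)%N -> (j.+1 < 2 ^ k)%N ->
  exists2 i, (0 < i < k)%N & starts_falling (@profile R k i) (breakpoint j)%:R.
Proof.
elim: k j => [|[|k] IHk] j; rewrite ?expn0 ?expn1; [lia|lia|].
move: k.+1 (ltn0Sn k) IHk => K K_gt0 IHk j_gt0 jK.
have half : starts_falling (@profile R K.+1 K) (useq R K.+1 - 1).
  move=> t t01; rewrite !profile_step // !profile_out //.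
  rewrite (@drop0 _ _ (_ - t)) ?(@drop0 _ _ (_ - 1)) ?(@drop_mid _ _ (_ + t));
    try lra.
  by rewrite !addr0; split=> //; min_max_lra.
have lower l : (0 < l)%N -> (l < 2 ^ K)%N -> exists2 i, (0 < i < K.+1)%N &
    starts_falling (@profile R K.+1 i) (breakpoint l)%:R.
  move=> l_gt0 lK; have [lK1|Kl] := ltnP l.+1 (2 ^ K).
    have [i /andP[i_gt0 iK] fi] := IHk _ l_gt0 lK1.
    exists i => [|t t01]; first by rewrite i_gt0 ltnW.
    (* Keeps the window of radius 1 where the profile is still that of level K. *)
    have : (breakpoint l)%:R + 1 <= useq R K.+1 - 1.
      rewrite breakpointS // -(natrD _ _ 1) ler_nat addn1 ltn_breakpoint //.
      by rewrite ltn_subRL add1n.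
    by move=> le1; rewrite !profile_id ?(ltnW iK) //; [exact: fi|lra..].
  exists K; first by rewrite K_gt0 leqnn.
  suff -> : l = (2 ^ K - 1)%N by rewrite -breakpointS.
  by lia.
have [jK2|Kj] := ltnP j (2 ^ K); first exact: lower.
have powS : (2 ^ K.+1 = 2 * 2 ^ K)%N by rewrite expnS.
(* Reflection reverses time and exchanges motion with rest, so it sends starts to starts. *)
have [i iK fi] := lower (2 ^ K.+1 - 1 - j)%N ltac:(lia) ltac:(lia).
exists i => // t t01; have /andP[_ iltK] := iK.
move: fi; rewrite breakpointB //; last by lia.
move=> fi; have [] := fi t t01.
set s := (breakpoint j)%:R.
have sym := @profile_sym R _ i _ iltK.
have := sym (s - t); have := sym (s + t); have := sym s.
have -> : 2 * useq R K.+1 - (s - t) = 2 * useq R K.+1 - s + t by ring.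
have -> : 2 * useq R K.+1 - (s + t) = 2 * useq R K.+1 - s - t by ring.
by move=> ? ? ? ? ?; split; lra.
Qed.

(** The pattern of falling then resting is preserved by the reflection, so the upper half follows
    from the lower one, which is level k - 1. Only the central piece [u_k - 1, u_k + 1], where the
    tent map is constant, is computed directly. *)
Lemma falls_then_rests_profile (R : realType) (k i j : nat) :
  (0 < i < k)%N -> (j.+1 < 2 ^ k)%N ->
  falls_then_rests (@profile R k i) (breakpoint j)%:R (breakpoint j.+1)%:R.
Proof.
elim: k i j => [|[|k] IHk] i j; [lia|lia|].
move: k.+1 (ltn0Sn k) IHk => K K_gt0 IHk /andP[i_gt0 iK] jK.
have powS : (2 ^ K.+1 = 2 * 2 ^ K)%N by rewrite expnS.
have lower l : (l.+1 < 2 ^ K)%N -> falls_then_rests (@profile R K.+1 i)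
    (breakpoint l)%:R (breakpoint l.+1)%:R.
  move=> lK t tl.
  have lS : (breakpoint l)%:R <= (breakpoint l.+1)%:R :> R.
    by rewrite ler_nat leq_breakpoint.
  have le1 : (breakpoint l.+1)%:R <= useq R K.+1 - 1.
    by rewrite breakpointS // ler_nat leq_breakpoint //; lia.
  rewrite !profile_id //; try lra.
  move: iK; rewrite ltnS leq_eqVlt => /orP[/eqP->|iK].
    by rewrite !profile_out //; min_max_lra.
  by apply: IHk => //; rewrite i_gt0.
have [jK2|Kj] := ltnP j.+1 (2 ^ K); first exact: lower.
have [jE|jN] := eqVneq j (2 ^ K - 1)%N.
  have -> : j.+1 = (2 ^ K.+1 - 1 - j)%N by lia.
  rewrite breakpointB //; last by lia.
  rewrite jE -breakpointS // => t tm.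
  rewrite !profile_step // !tent_mid ?drop_mid; try lra.
  by min_max_lra.
have := lower (2 ^ K.+1 - 1 - j.+1)%N ltac:(lia).
have -> : (2 ^ K.+1 - 1 - j.+1).+1 = (2 ^ K.+1 - 1 - j)%N by lia.
rewrite !breakpointB //; try lia.
move: (breakpoint j)%:R (breakpoint j.+1)%:R => a b fl t tab.
have := fl (2 * useq R K.+1 - t) ltac:(lra).
rewrite !profile_sym //; min_max_lra.
Qed.

(** * Closed form of the central path for nonnegative parameters *)

Definition path_coord {R : realType} (n k : nat) (t : R) : R :=
  if (k < n)%N then profile n k t else - t.

Definition central_point {R : realType} (n : nat) (t : R) : 'I_n -> \bar R :=
  fun k => (path_coord n k.+1 t)%:E.

Local Open Scope ereal_scope.

(* With the fictitious value 0 for the last coordinate, the constant -u_n and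
   the constraint x_(n-1) <= 0 become instances of the generic terms. *)
Definition head_coord {R : realType} (n : nat) (x : nat -> \bar R) (j : nat) :
    \bar R :=
  if (j < n)%N then x j else 0.

Definition cex_rhs {R : realType} (n : nat) (x : nat -> \bar R) (i : nat) :
    \bar R :=
  maxe (\big[maxe/-oo]_(i.+1 <= j < n.+1) ((- useq R j)%:E + head_coord n x j))
       (x n).

Lemma cex_rhsE (R : realType) (n : nat) (x : nat -> \bar R) (i : nat) :
  (i < n)%N ->
  maxe (maxe (\big[maxe/-oo]_(i.+1 <= j < n) ((- useq R j)%:E + x j)) (x n))
       (- useq R n)%:E = cex_rhs n x i.
Proof.
move=> i_n; rewrite /cex_rhs big_nat_recr //= /head_coord ltnn adde0 maxAC.
by congr (maxe (maxe _ _) _); apply: eq_big_nat => j /andP[_ ->].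
Qed.

Lemma cex_rhs_last (R : realType) (n : nat) (x : nat -> \bar R) :
  cex_rhs n x n = x n.
Proof. by rewrite /cex_rhs big_geq // maxNye. Qed.

Lemma cex_rhs_pred (R : realType) (n : nat) (x : nat -> \bar R) (i : nat) :
  (i < n)%N ->
  cex_rhs n x i =
    maxe ((- useq R i.+1)%:E + head_coord n x i.+1) (cex_rhs n x i.+1).
Proof. by move=> i_n; rewrite /cex_rhs big_ltn // maxA. Qed.

Lemma coord_ord (R : realType) (n : nat) (x : 'I_n -> \bar R) (k : 'I_n) :
  Defs.coord x k.+1 = x k.
Proof. by rewrite /Defs.coord valK. Qed.

Lemma down_ind (n : nat) (P : nat -> Prop) : P n ->
  (forall i, (0 < i < n)%N -> P i.+1 -> P i) ->
  forall i, (0 < i <= n)%N -> P i.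
Proof.
move=> Pn PS; suff Pm m i : (0 < i <= n)%N -> (n - i <= m)%N -> P i.
  by move=> i i_n; apply: (Pm n); rewrite // leq_subr.
elim: m i => [|m IHm] i i_n im.
  by have -> : i = n by lia.
have [->//|ineq] := eqVneq i n.
by apply: PS; [lia|apply: IHm; lia].
Qed.

Lemma bigmaxe_le (R : realType) (m n : nat) (F : nat -> \bar R) (z : \bar R) :
  \big[maxe/-oo]_(m <= j < n) F j <= z <->
  forall j, (m <= j < n)%N -> F j <= z.
Proof.
split=> [le_z j mn|le_z].
  apply: le_trans le_z.
  by apply: le_bigmax_seq; rewrite ?mem_index_iota.
rewrite big_seq; apply: (big_ind (fun y => y <= z)).
- exact: leNye.
- by move=> y y' yz y'z; rewrite ge_max yz.
- by move=> j; rewrite mem_index_iota => /le_z.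
Qed.

Lemma lee_shift (R : realType) (c : R) (x y : \bar R) :
  (c%:E + x <= y) = (x <= (- c)%:E + y).
Proof. by rewrite EFinN addeC -leeBrDr // addeC. Qed.

(** By monotonicity, only j = i - 1 matters among the terms x_j with j < i. What remains links x_i
    to the data at i + 1: exactly the three bounds in [drop]. For i = n - 1 the second one is
    x_(n-1) <= u_n + x_n. *)
Lemma cex_tropical_pointsP (R : realType) (n : nat) (t : R) (x : 'I_n -> \bar R) :
  (0 < n)%N ->
  cex_tropical_points n t x <->
  [/\ Defs.coord x n <= (- t)%:E, Defs.coord x n <= 0 &
      forall i, (0 < i < n)%N ->
        [/\ Defs.coord x i <= head_coord n (Defs.coord x) i.+1,
            (- useq R i.+1)%:E + Defs.coord x i <= cex_rhs n (Defs.coord x) i.+1 &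
            (- useq R i.+1 + 1)%:E + Defs.coord x i <=
            cex_rhs n (Defs.coord x) i]].
Proof.
move=> n_gt0; rewrite /cex_tropical_points /=; split.
- case=> [_ xnt cex /bigmaxe_le x_le0 [x_mono x_last]].
  split=> //; first by apply: x_le0; rewrite n_gt0 /=.
  move=> i /andP[i_gt0 i_n].
  have := cex i; rewrite i_gt0 i_n => /(_ isT).
  rewrite cex_rhsE // ge_max => /andP[_ cex_i].
  have [iSn|nSi] := ltnP i.+1 n.
    split=> //; first by rewrite /head_coord iSn; exact: x_mono.
    have := cex i.+1; rewrite iSn => /(_ isT).
    rewrite cex_rhsE // ge_max => /andP[/bigmaxe_le + _].
    by apply; rewrite i_gt0 /=.
  have En : i.+1 = n by apply/eqP; rewrite eqn_leq nSi i_n.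
  split=> //.
    by rewrite /head_coord En ltnn; apply: x_le0; rewrite i_gt0 /= -En ltnS ltnW.
  rewrite En cex_rhs_last.
  have : (1 < n)%N by rewrite -En.
  have -> : i = n.-1 by rewrite -En.
  move=> /x_last.
  by rewrite lee_shift opprK.
- case=> xnt xn0 steps.
  have x_le0 : forall i, (0 < i <= n)%N -> Defs.coord x i <= 0.
    apply: down_ind => // i i_n xS; have [xi _ _] := steps i i_n.
    by apply: le_trans xi _; rewrite /head_coord; case: ifP.
  have x_mono i : (0 < i)%N -> (i.+1 < n)%N ->
      Defs.coord x i <= Defs.coord x i.+1.
    move=> i_gt0 iSn; have := steps i; rewrite i_gt0 ltnW // => /(_ isT)[].
    by rewrite /head_coord iSn.
  split=> //.
  + move=> k; rewrite -coord_ord; apply: le_lt_trans (ltry 0).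
    by apply: x_le0; rewrite /= ltn_ord.
  + move=> i /andP[i_gt0 i_n]; rewrite cex_rhsE // ge_max.
    have := steps i; rewrite i_gt0 i_n => /(_ isT)[_ _ ->]; rewrite andbT.
    apply/bigmaxe_le => j /andP[j_gt0 ji].
    case: i i_gt0 i_n ji => // i _ i_n ji.
    have i_gt0 : (0 < i)%N by lia.
    have := steps i; rewrite i_gt0 ltnW // => /(_ isT)[_ + _].
    apply: le_trans; apply: leeD2l.
    have : (i < n)%N by lia.
    move: ji; rewrite ltnS; elim: i {i_n i_gt0} => [|i IHi]; first by lia.
    rewrite leq_eqVlt => /orP[/eqP->//|ji] i_n.
    by apply: le_trans (IHi ji (ltnW i_n)) _; apply: x_mono => //; lia.
  + by apply/bigmaxe_le => j j_n; apply: x_le0; rewrite -ltnS.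
  + split=> // n_gt1.
    have := steps n.-1; rewrite ltn_predL n_gt0 andbT -ltnS prednK //.
    move=> /(_ n_gt1)[_ + _]; rewrite cex_rhs_last.
    by rewrite lee_shift opprK.
Qed.

Lemma coord_central_point (R : realType) (n : nat) (t : R) (j : nat) :
  (0 < j <= n)%N -> Defs.coord (central_point n t) j = (path_coord n j t)%:E.
Proof.
case: j => // j /andP[_ jn].
by rewrite -[j.+1]/(nat_of_ord (Ordinal jn)).+1 coord_ord.
Qed.

Lemma head_central_point (R : realType) (n : nat) (t : R) (j : nat) :
  (0 < j <= n)%N -> head_coord n (Defs.coord (central_point n t)) j =
  (profile n j t)%:E.
Proof.
move=> j_n; rewrite /head_coord coord_central_point // /path_coord.
by case: ltnP => // nj; rewrite profile_out.
Qed.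

Lemma rhs_central_point (R : realType) (n : nat) (t : R) (i : nat) :
  (0 < n)%N -> (0 < i <= n)%N ->
  cex_rhs n (Defs.coord (central_point n t)) i =
  (profile n i t - level n i t)%:E.
Proof.
move=> n_gt0; move: i; apply: down_ind => [|i /andP[i_gt0 i_n] IHi].
  rewrite cex_rhs_last coord_central_point ?n_gt0 //=.
  by rewrite /path_coord ltnn profile_out // level_out // sub0r.
rewrite cex_rhs_pred // IHi head_central_point ?i_n //.
rewrite (profile_pred R n i _ i_n) (level_pred R n i _ i_n).
rewrite -addrA dropB_tent -EFinD -EFin_max.
by congr _%:E; min_max_lra.
Qed.

Lemma central_point_feasible (R : realType) (n : nat) (t : R) :
  (0 < n)%N -> (0 <= t)%R -> cex_tropical_points n t (central_point n t).
Proof.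
move=> n_gt0 t_ge0; apply/cex_tropical_pointsP => //.
rewrite coord_central_point ?n_gt0 /= // {1 2}/path_coord ltnn lexx.
split=> //; first by rewrite lee_fin oppr_le0.
move=> i /andP[i_gt0 i_n].
have iSn : (0 < i.+1 <= n)%N by [].
have in_ : (0 < i <= n)%N by rewrite i_gt0 ltnW.
rewrite head_central_point // !rhs_central_point // coord_central_point //.
rewrite /path_coord i_n -!EFinD !lee_fin.
rewrite (profile_pred R n i _ i_n) (level_pred R n i _ i_n).
by rewrite /drop /tent; split; min_max_lra.
Qed.

(** Coordinates and right-hand sides are bounded together, from n down: R_i is monotone in the
    coordinates above i, and the central point attains the least of the three bounds on x_i. *)
Lemma central_point_greatest (R : realType) (n : nat) (t : R)
    (x : 'I_n -> \bar R) (k : 'I_n) :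
  cex_tropical_points n t x -> x k <= central_point n t k.
Proof.
have n_gt0 : (0 < n)%N by apply: leq_ltn_trans (ltn_ord k).
move=> /cex_tropical_pointsP -/(_ n_gt0) [xnt xn0 steps].
suff main i : (0 < i <= n)%N -> Defs.coord x i <= (path_coord n i t)%:E /\
  cex_rhs n (Defs.coord x) i <= cex_rhs n (Defs.coord (central_point n t)) i.
  by rewrite -coord_ord; apply: (proj1 (main k.+1 _)); rewrite /= ltn_ord.
move: i; apply: down_ind.
  rewrite !cex_rhs_last coord_central_point ?n_gt0 //=.
  by rewrite /path_coord ltnn.
move=> i /andP[i_gt0 i_n] [xS rhsS].
have headS : head_coord n (Defs.coord x) i.+1 <= (profile n i.+1 t)%:E.
  move: xS; rewrite /head_coord /path_coord; case: ltnP => // nS _.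
  by rewrite profile_out.
have rhs_i : cex_rhs n (Defs.coord x) i <=
    cex_rhs n (Defs.coord (central_point n t)) i.
  rewrite !(cex_rhs_pred R n _ i i_n) ge_max.
  apply/andP; split; rewrite le_max; apply/orP; [left|right => //].
  by rewrite head_central_point //= leeD2l.
have := steps i; rewrite i_gt0 i_n => /(_ isT)[].
move=> /le_trans/(_ headS) + /le_trans/(_ rhsS) + /le_trans/(_ rhs_i).
rewrite !lee_shift rhs_central_point ?rhs_central_point // ?i_gt0 ?(ltnW i_n) //.
move=> xi_le1 xi_le2 xi_le3; split; last first.
  by rewrite -rhs_central_point ?i_gt0 // ltnW.
rewrite /path_coord i_n; move: xi_le1 xi_le2 xi_le3.
case: (Defs.coord x i) => [r| |]; rewrite ?leNye ?leye_eq //.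
rewrite -!EFinD !lee_fin.
rewrite (profile_pred R n i _ i_n) (level_pred R n i _ i_n) /drop /tent.
by min_max_lra.
Qed.

Lemma tropical_central_pathE (R : realType) (n : nat) (t : R) :
  (0 < n)%N -> (0 <= t)%R -> tropical_central_path n t = central_point n t.
Proof.
move=> n_gt0 t_ge0; apply/funext => k; apply/le_anti/andP; split.
  by apply: ge_ereal_sup => _ [x xP <-]; exact: central_point_greatest.
apply: ereal_sup_ubound; exists (central_point n t) => //.
exact: central_point_feasible.
Qed.

(** * Behaviour at infinity, and the pieces between breakpoints *)

Lemma path_coord_tail (R : realType) (n k : nat) (a t : R) :
  (0 < k)%N -> (2 * useq R n - 1 <= a <= t)%R ->
  path_coord n k t = (path_coord n k a - (t - a))%R.
Proof.
move=> k_gt0 a_t; rewrite /path_coord; case: ifP => kn; last by lra.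
by rewrite !profile_tail ?k_gt0 ?kn //; lra.
Qed.

Lemma extended_central_path_pinfty (R : realType) (n : nat) : (0 < n)%N ->
  extended_central_path n (+oo : \bar R) = fun=> -oo.
Proof.
move=> n_gt0; apply/funext => k /=; apply/cvg_lim; first exact: ereal_hausdorff.
apply/cvgeNyPle => A.
(* From [a] on all coordinates fall with slope -1; the closed form also requires a nonnegative
   parameter. *)
pose a := Num.max 0%R (2 * useq R n - 1)%R.
near=> t.
have at_ : (a <= t)%R by near: t; apply: nbhs_pinfty_ge; exact: num_real.
have At : (path_coord n k.+1 a + a - A <= t)%R.
  by near: t; apply: nbhs_pinfty_ge; exact: num_real.
have a_ge0 : (0 <= a)%R by rewrite le_max lexx.
have a_ge : (2 * useq R n - 1 <= a)%R by rewrite le_max lexx orbT.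
have t_ge0 := le_trans a_ge0 at_.
rewrite tropical_central_pathE // /central_point lee_fin.
by rewrite (path_coord_tail _ _ _ a) ?a_ge //; lra.
Unshelve. all: by end_near.
Qed.

Lemma falls_then_rests_path (R : realType) (n k j : nat) (t : R) :
  (0 < k)%N -> (j.+1 < 2 ^ n)%N ->
  ((breakpoint j)%:R <= t <= (breakpoint j.+1)%:R)%R ->
  path_coord n k t =
    Num.max (path_coord n k (breakpoint j)%:R - (t - (breakpoint j)%:R))%R
            (path_coord n k (breakpoint j.+1)%:R).
Proof.
move=> k_gt0 jn tj; rewrite /path_coord; case: ifP => kn; last by min_max_lra.
by apply: falls_then_rests_profile; rewrite // k_gt0.
Qed.

(** The parameter t corresponds to l = a - t, m = 0. The other points of the segment are ends: m < 0
    forces l = 0 and gives C a, since C b <= C a, and l < a - b gives C b. *)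
Lemma image_eq_tsegm (R : realType) (n : nat)
    (C : \bar R -> 'I_n -> \bar R) (a : R) (b : \bar R) :
  a%:E <= b ->
  (forall t, a%:E <= t <= b ->
     C t = fun k => maxe (C a%:E k + (a%:E - t)) (C b k)) ->
  C @` [set t | a%:E <= t <= b] = tsegm (C a%:E) (C b).
Proof.
move=> ab falls; apply/seteqP; split=> [_ [t /= a_t_b <-]|z [l [m [lm0 ->]]]].
  exists (a%:E - t), 0; split.
    by apply/max_idPr; rewrite sube_le0 //; case/andP: a_t_b.
  by rewrite falls //; apply/funext => k; rewrite adde0.
have [l_le0 m_le0] : l <= 0 /\ m <= 0 by rewrite -lm0 !le_max !lexx orbT.
have Cba k : C b k <= C a%:E k.
  by rewrite [C a%:E]falls ?lexx // le_max lexx orbT.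
have [m0|m_neq0] := eqVneq m 0; last first.
  have l0 : l = 0.
    by move: lm0; rewrite /maxe; case: ifP => // _ /eqP; rewrite (negbTE m_neq0).
  exists a%:E; first by rewrite /= lexx.
  apply/funext => k; rewrite l0 adde0; apply/esym/max_idPl.
  apply: le_trans (Cba k); rewrite -[leRHS]adde0; exact: leeD2l.
rewrite m0; case: l l_le0 {lm0} => [l| |] // l_le0; last first.
  exists b; first by rewrite /= ab lexx.
  apply/funext => k; rewrite adde0; apply/esym/max_idPr.
  by case: (C a%:E k) => *; rewrite addeNy leNye.
have [lb|bl] := leP (a - l)%:E b.
  exists (a - l)%:E.
    by rewrite /= lb lee_fin andbT; move: l_le0; rewrite lee_fin; lra.
  rewrite falls; last by rewrite lb lee_fin andbT; move: l_le0; rewrite lee_fin; lra.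
  apply/funext => k; rewrite adde0 -EFinB; congr (maxe (_ + _%:E) _); lra.
exists b; first by rewrite /= ab lexx.
apply/funext => k; rewrite adde0; apply/esym/max_idPr.
have -> : C b k = maxe (C a%:E k + (a%:E - b)) (C b k).
  by rewrite {1}(falls b) ?ab ?lexx.
rewrite le_max; apply/orP; left; apply: leeD2l.
by case: b ab bl {falls Cba} => [b| |] //; rewrite !lee_fin lte_fin; lra.
Qed.

Lemma extended_central_pathE (R : realType) (n : nat) (t : R) (k : 'I_n) :
  (0 <= t)%R -> extended_central_path n t%:E k = (path_coord n k.+1 t)%:E.
Proof.
move=> t_ge0; have n_gt0 : (0 < n)%N by apply: leq_ltn_trans (ltn_ord k).
by rewrite /= tropical_central_pathE.
Qed.

Lemma breakpoint_piece (R : realType) (n i : nat) : (i.+1 < 2 ^ n)%N ->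
  @extended_central_path R n @`
    [set t | (breakpoint i)%:R%:E <= t <= (breakpoint i.+1)%:R%:E] =
  tsegm (extended_central_path n (breakpoint i)%:R%:E)
        (extended_central_path n (breakpoint i.+1)%:R%:E).
Proof.
move=> i_n; apply: image_eq_tsegm.
  by rewrite lee_fin ler_nat leq_breakpoint.
case=> [t| |]; rewrite ?leye_eq ?andbF // !lee_fin => t_i.
have bp_ge0 j : (0 <= (breakpoint j)%:R :> R)%R by exact: ler0n.
have t_ge0 : (0 <= t)%R by have := bp_ge0 i; lra.
apply/funext => k; rewrite !extended_central_pathE //.
by rewrite -EFinB -EFinD -EFin_max (falls_then_rests_path _ _ _ i) // opprB.
Qed.

Lemma breakpoint_penultimate (R : realType) (n : nat) : (0 < n)%N ->
  (breakpoint (2 ^ n - 2))%:R = (2 * useq R n - 1)%R.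
Proof.
move=> n_gt0; rewrite useq_breakpoint // /breakpoint.
case: n n_gt0 => // n _; rewrite expnS.
have : (0 < 2 ^ n)%N by rewrite expn_gt0.
move: (2 ^ n)%N => m m_gt0.
by rewrite -[1%R]/(1%:R) -natrB; [congr _%:R|]; lia.
Qed.

(** The right end is -oo in every coordinate, hence neutral for the maximum, and a uniform descent
    has the required form. *)
Lemma last_piece (R : realType) (n : nat) : (0 < n)%N ->
  @extended_central_path R n @`
    [set t | (breakpoint (2 ^ n - 2))%:R%:E <= t <= +oo] =
  tsegm (extended_central_path n (breakpoint (2 ^ n - 2))%:R%:E)
        (extended_central_path n +oo).
Proof.
move=> n_gt0; apply: image_eq_tsegm; first exact: leey.
have aE := breakpoint_penultimate R n n_gt0.
case=> [t| |] //; rewrite extended_central_path_pinfty // => t_a;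
  apply/funext => k; rewrite maxeNy ?addeNy //.
move: t_a; rewrite leey andbT lee_fin => at_.
have a_ge0 : (0 <= (breakpoint (2 ^ n - 2))%:R :> R)%R by exact: ler0n.
rewrite !extended_central_pathE //; last by lra.
rewrite -EFinB -EFinD (path_coord_tail _ _ _ (breakpoint (2 ^ n - 2))%:R) //.
  by rewrite opprB.
by rewrite -aE lexx.
Qed.

(** * Obstruction by an interior start, and the count of pieces *)

(** At s both the starting coordinate and the last one still exceed their values at b, so on a
    segment both would be those of the left end shifted by the same l. But the last one has moved by
    s - a, and the other, at rest just before s, by strictly less. *)
Lemma start_not_inside (R : realType) (n j : nat) (a : R) (b : \bar R) :
  (0 < j)%N -> (j.+1 < 2 ^ n)%N ->
  (0 <= a < (breakpoint j)%:R)%R -> (breakpoint j)%:R%:E < b ->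
  extended_central_path n @` [set t | a%:E <= t <= b] <>
  tsegm (extended_central_path n a%:E) (extended_central_path n b).
Proof.
move=> j_gt0 j_n /andP[a_ge0 a_s] s_b eqC.
have [i /andP[i_gt0 i_n] start] := starts_falling_profile R n j j_gt0 j_n.
have n_gt0 : (0 < n)%N by apply: leq_ltn_trans i_n.
move: (breakpoint j)%:R a_s s_b start => s a_s s_b start.
have s_ge0 : (0 <= s)%R by lra.
have k_n : (i.-1 < n)%N by lia.
have last_n : (n.-1 < n)%N by lia.
pose k := Ordinal k_n; pose last := Ordinal last_n.
have kE : k.+1 = i by rewrite /= prednK.
have lastE : last.+1 = n by rewrite /= prednK.
have lastC c : (0 <= c)%R ->
    extended_central_path n c%:E last = (- c)%:E :> \bar R.
  by move=> c_ge0; rewrite extended_central_pathE // lastE /path_coord ltnn.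
have kC c : (0 <= c)%R ->
    extended_central_path n c%:E k = (profile n i c)%:E :> \bar R.
  by move=> c_ge0; rewrite extended_central_pathE // kE /path_coord i_n.
have [b_last b_k] : extended_central_path n b last < (- s)%:E /\
    extended_central_path n b k < (profile n i s)%:E.
  case: b s_b {eqC} => [b| |] //; last first.
    by move=> _; rewrite extended_central_path_pinfty // !ltNyr.
  rewrite lte_fin => s_b; rewrite lastC ?kC; [|lra..].
  rewrite !lte_fin; split; first by lra.
  (* The start controls only one unit after s; monotonicity handles the rest. *)
  have [b_s1|s1_b] := leP b (s + 1)%R.
    have [_] := start (b - s)%R ltac:(lra).
    by rewrite (_ : s + (b - s) = b)%R; [lra|ring].
  have [_] := start 1%R ltac:(lra).
  by have := profile_lipschitz R n i _ _ (ltW s1_b); lra.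
have : tsegm (extended_central_path n a%:E) (extended_central_path n b)
    (extended_central_path n s%:E).
  by rewrite -eqC; exists s%:E => //=; rewrite lee_fin !ltW.
case=> l [m [lm0 eqs]].
have [l_le0 m_le0] : l <= 0 /\ m <= 0 by rewrite -lm0 !le_max !lexx orbT.
have left_wins (x y z : \bar R) : y < z -> z = maxe (x + l) (y + m) -> z = x + l.
  move=> y_z; rewrite /maxe; case: ifP => // _ zE; move: y_z; rewrite {1}zE.
  by rewrite ltNge -[leRHS]adde0 leeD2l.
have := left_wins _ _ _ _ (congr1 (fun f => f k) eqs).
have := left_wins _ _ _ _ (congr1 (fun f => f last) eqs).
rewrite !lastC // !kC // => /(_ b_last) s_l /(_ b_k).
move: s_l; case: l {lm0 l_le0 eqs left_wins} => [l| |] //.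
move=> [s_l] [p_l].
have [s1_a|a_s1] := leP (s - 1)%R a.
  have [+ _] := start (s - a)%R ltac:(lra).
  by rewrite (_ : s - (s - a) = a)%R; [lra|ring].
have [+ _] := start 1%R ltac:(lra).
by have := profile_lipschitz R n i _ _ (ltW a_s1); lra.
Qed.

(* The last piece may be stopped at +oo: the path moves along (1, ..., 1) from
   the breakpoint 2 u_n - 1 on. *)
Definition gamma_endpoint {R : realType} (n p : nat) (b : \bar R) : Prop :=
  b = (breakpoint p)%:R%:E \/ p.+1 = (2 ^ n)%N /\ b = +oo.

Lemma breakpoint_pieces (R : realType) (n p : nat) (b : \bar R) :
  (0 < n)%N -> (p < 2 ^ n)%N -> gamma_endpoint n p b ->
  central_path_pieces n 0%:E b p.
Proof.
move=> n_gt0 p_n bP.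
have n2 : (1 < 2 ^ n)%N by rewrite -[1%N](expn0 2) ltn_exp2l.
have le_b i : (i < p)%N -> (breakpoint i)%:R%:E <= b.
  case: bP => [-> i_p|[_ ->] _]; last exact: leey.
  by rewrite lee_fin ler_nat leq_breakpoint // ltnW.
(* The last parameter is [b] itself, as it may be +oo instead of a breakpoint. *)
exists (fun i => if (i < p)%N then (breakpoint i)%:R%:E else b); split.
- case: ifP => // p0; case: bP => [->|[p1 _]]; last by lia.
  by have -> : p = 0%N by lia.
- by rewrite ltnn.
- move=> i i_p; rewrite i_p; case: ifP => _; last exact: le_b.
  by rewrite lee_fin ler_nat leq_breakpoint.
- move=> i i_p; rewrite i_p; have [iSp|pSi] := ltnP i.+1 p.
    by apply: breakpoint_piece; apply: ltn_trans p_n.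
  have pE : p = i.+1 by lia.
  case: bP => [->|[p1 ->]].
    by rewrite pE; apply: breakpoint_piece; rewrite -pE.
  have -> : i = (2 ^ n - 2)%N by lia.
  exact: last_piece.
Qed.

(** Each of the p - 1 breakpoints strictly between the ends must be one of the q - 1 interior
    subdivision points. *)
Lemma leq_pieces (R : realType) (n p q : nat) (b : \bar R) :
  (0 < n)%N -> (p < 2 ^ n)%N -> gamma_endpoint n p b ->
  central_path_pieces n (0%:E) b q -> (p <= q)%N.
Proof.
move=> n_gt0 p_n bP [lam [lam0 lamq lam_mono lam_seg]].
have [->//|p_neq0] := eqVneq p 0%N; have p_gt0 : (0 < p)%N by lia.
have lt_b j : (j < p)%N -> (breakpoint j)%:R%:E < b.
  case: bP => [-> j_p|[_ ->] _]; last exact: ltry.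
  by rewrite lte_fin ltr_nat ltn_breakpoint.
have q_gt0 : (0 < q)%N.
  case: q lamq {lam_mono lam_seg} => // lamq.
  by have := lt_b 0%N p_gt0; rewrite -lamq lam0 ltxx.
have lam_ge0 i : (i <= q)%N -> 0 <= lam i.
  elim: i => [|i IHi] i_q; first by rewrite lam0.
  by apply: le_trans (lam_mono i i_q); apply: IHi; exact: ltnW.
have cut j : (0 < j < p)%N ->
    exists2 i, (0 < i < q)%N & lam i = (breakpoint j)%:R%:E.
  move=> /andP[j_gt0 j_p]; set s := (breakpoint j)%:R%:E.
  have ex_i : exists i, s <= lam i by exists q; rewrite lamq ltW // lt_b.
  (* For the first parameter reaching s, either it equals s or s lies strictly inside the piece that
     it closes. *)
  case: (ex_minnP ex_i) => i s_i i_min.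
  have i_q : (i <= q)%N by apply: i_min; rewrite lamq ltW // lt_b.
  have i_gt0 : (0 < i)%N.
    case: i s_i {i_min i_q} => //; rewrite lam0 lee_fin (ler_nat _ _ 0).
    by have := ltn_breakpoint _ _ j_gt0; lia.
  have [s_eq|s_neq] := eqVneq (lam i) s.
    exists i => //; rewrite i_gt0 ltn_neqAle i_q andbT; apply/eqP => i_eq.
    by have := lt_b _ j_p; rewrite -lamq -i_eq s_eq ltxx.
  exfalso; case: i i_gt0 s_i i_min i_q s_neq => // i _ s_i i_min i_q s_neq.
  have i_s : lam i < s by rewrite ltNge; apply/negP => /i_min; rewrite ltnn.
  have := lam_ge0 i (ltnW i_q); have := lam_seg i i_q.
  case: (lam i) i_s => [a| |] //; rewrite lte_fin => a_s seg.
  rewrite lee_fin => a_ge0.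
  apply: (start_not_inside R n j a (lam i.+1)) seg => //.
  - exact: leq_ltn_trans p_n.
  - by rewrite a_ge0.
  - by rewrite lt_neqAle eq_sym s_neq.
have uniq_s : uniq [seq (breakpoint j)%:R%:E : \bar R | j <- iota 1 p.-1].
  rewrite map_inj_uniq ?iota_uniq // => j j' [] /eqP; rewrite eqr_nat => /eqP.
  by case: (ltngtP j j') => // /ltn_breakpoint; lia.
have := uniq_leq_size (s2 := map lam (iota 1 q.-1)) uniq_s.
rewrite !size_map !size_iota => le_size; suff : (p.-1 <= q.-1)%N by lia.
apply: le_size => _ /mapP[j + ->]; rewrite mem_iota => j_p.
have [i i_q <-] := cut j ltac:(lia).
by apply: map_f; rewrite mem_iota; lia.
Qed.

Lemma is_gamma_breakpoint (R : realType) (n p : nat) (b : \bar R) :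
  (0 < n)%N -> (p < 2 ^ n)%N -> gamma_endpoint n p b -> is_gamma n 0%R b p.
Proof.
move=> n_gt0 p_n bP; rewrite /is_gamma ifT; last first.
  by case: bP => [->|[_ ->]]; rewrite ?leey // lee_fin ler0n.
split; first exact: breakpoint_pieces.
by move=> q; exact: leq_pieces.
Qed.

Local Open Scope ring_scope.

Theorem theorem24 (R : realType) (n : nat) (hn : (1 <= n)%N) :
  [/\ is_gamma n (0 : R) (useq R n - 1)%:E (2 ^ n.-1 - 1)%N,
      is_gamma n (0 : R) (2 * useq R n - 1)%:E (2 ^ n - 2)%N,
      is_gamma n (0 : R) (2 * useq R n)%:E (2 ^ n - 1)%N
    & is_gamma n (0 : R) +oo%E (2 ^ n - 1)%N].
Proof.
have n2 : (1 < 2 ^ n)%N by rewrite -[1%N](expn0 2) ltn_exp2l.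
split; last 3 first.
- apply: is_gamma_breakpoint => //; first by lia.
  by left; rewrite breakpoint_penultimate.
- apply: is_gamma_breakpoint => //; first by lia.
  by left; rewrite useq_breakpoint.
- by apply: is_gamma_breakpoint => //; [lia|right; split=> //; lia].
case: n hn {n2} => [//|[|n]] _.
  (* For n = 1, u_1 - 1 = -1/2: the interval is empty and 2^0 - 1 = 0. *)
  rewrite /is_gamma lee_fin ifF //; apply/negbTE; rewrite -ltNge.
  by have := useq1 R; lra.
(* From index 2 on, u_n - 1 = 2 u_(n-1) is itself a breakpoint. *)
rewrite breakpointS //; apply: is_gamma_breakpoint => //; last by left.
by rewrite /= [ltnRHS]expnS; have : (0 < 2 ^ n.+1)%N; [rewrite expn_gt0|lia].
Qed.
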